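(* Let $m\ge 1$. For any infinite sequence of positive integers $a_1,a_2,a_3,\ldots$ and any $1\le i\le m$, the sequence of rational numbers $r_{i,m}(a_1,\ldots,a_n)$ converges (to a real number) as $n\to\infty$.
   Context: For a positive integer $a$ set $[\![a]\!]_k=\binom{a+k-1}{k}$ for $k\ge 0$ (so $[\![a]\!]_0=1$) and $[\![a]\!]_k=0$ for $k<0$. Let $\Lambda^{(m)}(a)$ be the $(m+1)\times(m+1)$ matrix whose $(i,j)$-entry is $[\![a]\!]_{m+2-i-j}$, $1\le i,j\le m+1$. For positive integers $a_1,\ldots,a_n$ let $X=\Lambda^{(m)}(a_1)\cdots\Lambda^{(m)}(a_n)$. The numbers $r_{i,m}(a_1,\ldots,a_n)$, $0\le i\le m$, are defined by saying that $(r_{m,m},r_{m-1,m},\ldots,r_{1,m},r_{0,m})^\top$ is the first column of $X$, normalized (scaled) so that $r_{0,m}=1$; that is, $r_{i,m}(a_1,\ldots,a_n)=X_{m+1-i,1}/X_{m+1,1}$. *)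

(* Defs.v *)
From HB Require Import structures.
From mathcomp Require Import all_boot all_order all_algebra.
From mathcomp Require Import all_classical all_reals all_analysis.

Set Implicit Arguments.
Unset Strict Implicit.
Unset Printing Implicit Defensive.

Import Order.TTheory GRing.Theory Num.Theory.
Import numFieldNormedType.Exports.

Local Open Scope classical_set_scope.
Local Open Scope ring_scope.

(* The number [[a]]_k of multisets of size k on a letters, for a > 0 and
   k : int; the natural-number predecessor is never truncated when a > 0. *)
Definition multichoose (a : nat) (k : int) : nat :=
  match k with
  | Posz k' => 'C((a + k').-1, k')
  | Negz _ => 0%N
  end.

(* Ordinals start at 0, so the row and column numbers of the usual 1-based
   convention are i.+1 and j.+1. *)
Definition Lambda (m a : nat) : 'M[rat]_(m.+1) :=
  \matrix_(i < m.+1, j < m.+1)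
    (multichoose a ((m.+2)%:Z - (i.+1)%:Z - (j.+1)%:Z))%:R.

Definition LambdaProd (m : nat) (s : seq nat) : 'M[rat]_(m.+1) :=
  \prod_(a <- s) Lambda m a.

(* The 1-based row m + 1 - i is the ordinal m - i (for i <= m).  When s is a
   nonempty sequence of positive integers the denominator is positive; for
   s = [::] and m > 0 it vanishes and the value is a junk 0. *)
Definition r (i m : nat) (s : seq nat) : rat :=
  LambdaProd m s (inord (m - i)) ord0 / LambdaProd m s ord_max ord0.

(* Main.v *)
Require Import Defs.
From HB Require Import structures.
From mathcomp Require Import all_boot all_order all_algebra.
From mathcomp Require Import all_classical all_reals all_analysis.
From mathcomp Require Import zify lra.

Set Implicit Arguments.
Unset Strict Implicit.
Unset Printing Implicit Defensive.

Import Order.TTheory GRing.Theory Num.Theory.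
Import numFieldNormedType.Exports.

Local Open Scope classical_set_scope.
Local Open Scope ring_scope.

(** The sequence converges geometrically, by a Doeblin-type contraction.  Let
    p and q be two rows of the partial product X_n, q being its last row, so
    that p_0 / q_0 is one of the numbers r_i (rows and columns are numbered from
    0), and enclose the quotients p_j / q_j of all the columns j in one interval
    [lo, hi].  The columns of X_(n+1) are nonnegative combinations of those of
    X_n, so their quotients are weighted averages of the previous ones and stay
    in the interval.  The weight of column k of X_n in column j of X_(n+1) is
    q_k * [[a]]_(m-k-j), and [[a]]_k is nondecreasing in k: this makes
    [[a]]_(m-k-j) largest at k = 0, and it also makes q_k largest at k = 0.
    So column 0 carries at least 1/(m+1) of the total weight, whatever a is.
    Hence all the new quotients are pulled towards the single number p_0 / q_0
    by the factor 1 - 1/(m+1), and the length of the enclosing interval is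
    multiplied by m/(m+1) at each step (enclosed_contract).  The quotients
    p_0 / q_0 therefore form a Cauchy sequence (cvg_dominated_quotient). *)

(** * Quotients of two rows in a product of column-dominated matrices *)

(** The condition p_j / q_j \in [lo, hi] with the division cleared. *)
Definition enclosed (R : numDomainType) (J : Type) (p q : J -> R) (lo hi : R) :=
  forall j, lo * q j <= p j <= hi * q j.

Section OneStep.
Context (R : realFieldType) (J : finType) (o : J).
Variables (c : J -> J -> R) (p q p' q' : J -> R).
Hypothesis c_ge0 : forall k j, 0 <= c k j.
Hypothesis c_le_row : forall k j, c k j <= c o j.
Hypothesis p'E : forall j, p' j = \sum_k p k * c k j.
Hypothesis q'E : forall j, q' j = \sum_k q k * c k j.

Lemma step_pos j : (forall k, 0 <= q k) -> 0 < q o -> 0 < c o j -> 0 < q' j.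
Proof.
move=> q_ge0 qo_gt0 co_gt0; rewrite q'E (bigD1 o) //= ltr_pwDl ?mulr_gt0 //.
by apply: sumr_ge0 => k _; rewrite mulr_ge0.
Qed.

Lemma step_dominated j :
  (forall k, 0 <= q k) -> (forall k, c k j <= c k o) -> q' j <= q' o.
Proof.
by move=> q_ge0 c_le; rewrite !q'E; apply: ler_sum => k _; rewrite ler_wpM2l.
Qed.

Lemma enclosed_step lo hi : enclosed p q lo hi -> enclosed p' q' lo hi.
Proof.
move=> enc j; rewrite p'E q'E !mulr_sumr.
by apply/andP; split; apply: ler_sum => k _; rewrite mulrA ler_wpM2r //;
  have /andP[] := enc k.
Qed.

(** All the terms of the sum defining q' j are at most the one of index o. *)
Lemma step_weight j : (forall k, 0 <= q k <= q o) ->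
  q' j / #|J|%:R <= q o * c o j.
Proof.
move=> q_bnd; have J_gt0 : 0 < #|J|%:R :> R
  by rewrite ltr0n; apply/card_gt0P; exists o.
rewrite ler_pdivrMr // mulr_natr q'E -sumr_const.
by apply: ler_sum => k _; have /andP[] := q_bnd k => *; apply: ler_pM.
Qed.

(** Every enclosing interval may be shrunk towards p o / q o: the deviation of
    p' j from lo * q' j is a sum of nonnegative terms, whose term of index o
    alone is, by step_weight, a fraction 1 / #|J| of what it would be if p' j
    equalled (p o / q o) * q' j.  The endpoint hi is symmetric. *)
Lemma enclosed_contract lo hi (x := p o / q o) (t := #|J|%:R^-1) :
  (forall k, 0 <= q k <= q o) -> 0 < q o -> enclosed p q lo hi ->
  enclosed p' q' (lo + t * (x - lo)) (hi - t * (hi - x)).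
Proof.
move=> q_bnd qo_gt0 enc j.
have pE : p o = x * q o by rewrite /x divfK ?gt_eqF.
have lox : 0 <= x - lo.
  by rewrite subr_ge0 -(ler_pM2r qo_gt0) -pE; have /andP[] := enc o.
have xhi : 0 <= hi - x.
  by rewrite subr_ge0 -(ler_pM2r qo_gt0) -pE; have /andP[] := enc o.
have w := step_weight j q_bnd; rewrite -/t in w.
have lo_dev : (x - lo) * (q o * c o j) <= p' j - lo * q' j.
  rewrite p'E q'E mulr_sumr -sumrB (bigD1 o) //= ler_wpDr //.
    apply: sumr_ge0 => k _; rewrite mulrA -mulrBl mulr_ge0 // subr_ge0.
    by have /andP[] := enc k.
  by rewrite pE; lra.
have hi_dev : (hi - x) * (q o * c o j) <= hi * q' j - p' j.
  rewrite p'E q'E mulr_sumr -sumrB (bigD1 o) //= ler_wpDr //.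
    apply: sumr_ge0 => k _; rewrite mulrA -mulrBl mulr_ge0 // subr_ge0.
    by have /andP[] := enc k.
  by rewrite pE; lra.
have := ler_wpM2l lox w; have := ler_wpM2l xhi w => w1 w2.
by apply/andP; split; lra.
Qed.

End OneStep.

Section DominatedProduct.
Context (R : realType) (J : finType) (o : J).
Variables (c : nat -> J -> J -> R) (p q : nat -> J -> R).
Hypothesis c_ge0 : forall n k j, 0 <= c n k j.
Hypothesis c_le_row : forall n k j, c n k j <= c n o j.
Hypothesis c_le_col : forall n k j, c n k j <= c n k o.
Hypothesis co_gt0 : forall n j, 0 < c n o j.
Hypothesis pE : forall n j, p n.+1 j = \sum_k p n k * c n k j.
Hypothesis qE : forall n j, q n.+1 j = \sum_k q n k * c n k j.
Hypothesis q0_ge0 : forall j, 0 <= q 0 j.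
Hypothesis q0o_gt0 : 0 < q 0 o.

Let q_ge0_gt0 n : (forall j, 0 <= q n j) /\ 0 < q n o.
Proof.
elim: n => [//|n [q_ge0 qo_gt0]].
have q_gt0 j : 0 < q n.+1 j by apply: (step_pos (o := o) (c_ge0 n) (qE n)).
by split=> // j; apply: ltW.
Qed.

(* The initial row q 0 may have zeros, and entries larger than q 0 o: positivity
   and domination by the entry of index o hold after one multiplication. *)
Let q_bnd n j : 0 <= q n.+1 j <= q n.+1 o.
Proof.
have [q_ge0 _] := q_ge0_gt0 n; have [-> _] /= := q_ge0_gt0 n.+1.
by apply: (step_dominated (qE n) q_ge0) => k; apply: c_le_col.
Qed.

Let q_gt0 n j : 0 < q n.+1 j.
Proof. by have [? ?] := q_ge0_gt0 n; apply: (step_pos (o := o) (c_ge0 n) (qE n)). Qed.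

Let enclosed_after n k lo hi :
  enclosed (p n) (q n) lo hi -> enclosed (p (k + n)) (q (k + n)) lo hi.
Proof.
move=> enc; elim: k => [//|k]; rewrite addSn.
exact: (enclosed_step (c_ge0 _) (pE _) (qE _)).
Qed.

Let theta : R := 1 - #|J|%:R^-1.

Let enclosed_geometric : exists D, forall n, exists lo hi,
  enclosed (p n.+1) (q n.+1) lo hi /\ hi - lo = D * theta ^+ n.
Proof.
pose D := \sum_j `|p 1 j| / q 1 j.
exists (D - - D); elim=> [|n [lo [hi [enc lohi]]]].
  exists (- D), D; split; last by rewrite expr0 mulr1.
  move=> j; rewrite mulNr -ler_norml -ler_pdivrMr // /D (bigD1 j) //=.
  by rewrite lerDl sumr_ge0 // => k _; rewrite divr_ge0 // ltW.
have enc' := enclosed_contract (c_ge0 _) (c_le_row _) (pE _) (qE _)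
  (q_bnd n) (q_gt0 n o) enc.
do 2!eexists; split; first exact: enc'.
by rewrite exprSr mulrA -lohi /theta; lra.
Qed.

(** No bound on the entries of the matrices c n is assumed: the contraction
    factor theta depends on the size of J only, since the hypotheses compare the
    entries of one matrix with each other. *)
Lemma cvg_dominated_quotient :
  exists l : R, (fun n => p n o / q n o) @ \oo --> l.
Proof.
apply/cvg_ex/cauchy_cvgP/cauchy_exP => e e_gt0.
have [D encD] := enclosed_geometric.
have J_ge1 : 1 <= #|J|%:R :> R by rewrite ler1n; apply/card_gt0P; exists o.
have theta_lt1 : `|theta| < 1.
  have J_gt0 : 0 < #|J|%:R :> R by apply: lt_le_trans J_ge1.
  have : 0 < #|J|%:R^-1 :> R by rewrite invr_gt0.
  have : #|J|%:R^-1 <= 1 :> R by rewrite invf_le1.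
  by rewrite /theta ltr_norml => *; apply/andP; split; lra.
have /cvgrPdist_lt /(_ _ e_gt0) [N _ /(_ N (leqnn N))] :
  D * theta ^+ n @[n --> \oo] --> (0 : R).
  by rewrite -(mulr0 D); apply: cvgMr; apply: cvg_expr.
have [lo [hi [enc lohi]]] := encD N.
rewrite /= sub0r normrN -lohi => width.
exists lo; exists N.+1 => // n /= Nn.
have /(_ o) := enclosed_after (n - N.+1) enc; rewrite subnK //.
have [_ qo_gt0] := q_ge0_gt0 n.
rewrite -ler_pdivlMr // -[X in _ && X]ler_pdivrMr // => /andP[ge_lo le_hi].
rewrite /ball /= distrC ger0_norm ?subr_ge0 //.
apply: le_lt_trans width; apply: le_trans (ler_norm _).
by rewrite lerB.
Qed.

End DominatedProduct.

(** * The matrices Lambda *)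

Lemma multichoose_gt0 (a k : nat) : (0 < a)%N -> (0 < multichoose a k)%N.
Proof. by move=> a_gt0; rewrite /multichoose bin_gt0; lia. Qed.

(** By symmetry of binomials, [[b + 1]]_k = 'C(b + k, b), and k occurs there in
    the upper argument only. *)
Lemma multichoose_mono (a : nat) (k l : int) : (0 < a)%N -> k <= l ->
  (multichoose a k <= multichoose a l)%N.
Proof.
case: a => // b _; case: k l => [k|k] [l|l] //=; rewrite lez_nat => kl.
have E n : 'C((b.+1 + n).-1, n) = 'C(b + n, b).
  by rewrite addSn /= -[RHS]bin_sub ?leq_addr // addKn.
by rewrite !E leq_bin2l // leq_add2l.
Qed.

Lemma LambdaProd_mkseqS (m : nat) (a : nat -> nat) (n : nat) (i j : 'I_m.+1) :
  LambdaProd m (mkseq a n.+1) i j =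
    \sum_k LambdaProd m (mkseq a n) i k * Lambda m (a n) k j.
Proof. by rewrite /LambdaProd mkseqS -cats1 big_cat big_seq1 mxE. Qed.

Theorem theorem1p2 (R : realType) (m : nat) (a : nat -> nat) (i : nat)
    (hm : (1 <= m)%N) (ha : forall k : nat, (0 < a k)%N)
    (hi : (1 <= i <= m)%N) :
  exists l : R, (fun n : nat => ratr (r i m (mkseq a n)) : R) @ \oo --> l.
Proof.
pose X n (i0 j : 'I_m.+1) : R := ratr (LambdaProd m (mkseq a n.+1) i0 j).
pose c n (k j : 'I_m.+1) : R := ratr (Lambda m (a n.+1) k j).
have cE n k j : c n k j =
    (multichoose (a n.+1) ((m.+2)%:Z - (k.+1)%:Z - (j.+1)%:Z))%:R.
  by rewrite /c mxE ratr_nat.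
have XE i0 n j : X n.+1 i0 j = \sum_k X n i0 k * c n k j.
  rewrite /X LambdaProd_mkseqS rmorph_sum /=.
  by apply: eq_bigr => k _; rewrite rmorphM.
have X0E i0 j : X 0%N i0 j =
    (multichoose (a 0%N) ((m.+2)%:Z - (i0.+1)%:Z - (j.+1)%:Z))%:R.
  by rewrite /X /LambdaProd big_seq1 mxE ratr_nat.
have [||||||l cvgl] := @cvg_dominated_quotient R 'I_m.+1 ord0 c
  (X ^~ (inord (m - i))) (X ^~ ord_max) _ _ _ _ (XE _) (XE _).
- by move=> n k j; rewrite cE ler0n.
- by move=> n k j; rewrite !cE ler_nat multichoose_mono //=; lia.
- by move=> n k j; rewrite !cE ler_nat multichoose_mono //=; lia.
- move=> n j; rewrite cE ltr0n.
  have -> : (m.+2)%:Z - (@ord0 m).+1%:Z - j.+1%:Z = (m - j)%N.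
    by have := ltn_ord j; rewrite /=; lia.
  exact: multichoose_gt0.
- by move=> j; rewrite X0E ler0n.
- rewrite X0E ltr0n.
  have -> : (m.+2)%:Z - (@ord_max m).+1%:Z - (@ord0 m).+1%:Z = 0%N by rewrite /=; lia.
  exact: multichoose_gt0.
(* X n is the product of n + 1 factors: the empty product, whose quotient is not
   defined, is left out. *)
exists l; rewrite -(cvg_shiftn 1) /=.
by under eq_cvg do rewrite addn1 /r fmorph_div.
Qed.
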